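(* Fix an integer $k\ge 2$. For all sufficiently large $n$, the graph $L(n,k)=K_k\vee\overline{K_{n-k}}$ satisfies \[ \chi(L(n,k))\le \frac{2\,GA(L(n,k))}{\overline{d}}, \] where $\overline{d}$ is the average degree of $L(n,k)$.
   Context: All graphs are finite, simple and undirected. $G_1\vee G_2$ denotes the join of $G_1$ and $G_2$ (disjoint union plus all edges between them); $\overline{K_{n-k}}$ is the edgeless graph on $n-k$ vertices; so $L(n,k)$ has $n$ vertices. $\chi$ denotes the chromatic number. With $d_i$ the degree of $v_i$ and sums over edges $i\sim j$ (each edge once), $GA(G)=\sum_{i\sim j}\frac{2\sqrt{d_id_j}}{d_i+d_j}$. The average degree is $\overline d=2m/n$ where $m$ is the number of edges. *)

(* Defs.v *)
From HB Require Import structures.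
From mathcomp Require Import all_boot all_order all_algebra.

Set Implicit Arguments.
Unset Strict Implicit.
Unset Printing Implicit Defensive.

Import Order.TTheory GRing.Theory Num.Theory.

Record sgraph := SGraph {
  vertex :> finType;
  adj : rel vertex;
  adj_sym : symmetric adj;
  adj_irrefl : irreflexive adj
}.

Lemma neq_sym (T : eqType) : symmetric (fun x y : T => x != y).
Proof. by move=> x y; rewrite eq_sym. Qed.

Lemma neq_irrefl (T : eqType) : irreflexive (fun x y : T => x != y).
Proof. by move=> x; rewrite eqxx. Qed.

Definition complete_graph (n : nat) : sgraph :=
  SGraph (@neq_sym 'I_n) (@neq_irrefl 'I_n).

Definition edgeless_graph (n : nat) : sgraph :=
  @SGraph 'I_n (fun _ _ => false) (fun _ _ => erefl) (fun _ => erefl).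

Section Join.
Variables G1 G2 : sgraph.

Definition join_adj : rel (G1 + G2)%type := fun u v =>
  match u, v with
  | inl x, inl y => adj x y
  | inr x, inr y => adj x y
  | _, _ => true
  end.

Lemma join_adj_sym : symmetric join_adj.
Proof. by move=> [x|x] [y|y] //=; rewrite adj_sym. Qed.

Lemma join_adj_irrefl : irreflexive join_adj.
Proof. by move=> [x|x] /=; rewrite adj_irrefl. Qed.

Definition join_graph : sgraph := SGraph join_adj_sym join_adj_irrefl.

End Join.

(* The subtraction is truncated, so this is the intended graph, on n vertices,
   only when k <= n. *)
Definition L (n k : nat) : sgraph :=
  join_graph (complete_graph k) (edgeless_graph (n - k)).

Lemma card_L (n k : nat) : k <= n -> #|L n k| = n.
Proof. by move=> le_kn; rewrite card_sum !card_ord subnKC. Qed.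

Section Invariants.
Variable G : sgraph.

Definition colorable (c : nat) : bool :=
  [exists f : {ffun G -> 'I_c},
     [forall x, forall y, adj x y ==> (f x != f y)]].

Lemma colorable_card : colorable #|G|.
Proof.
apply/existsP; exists [ffun x => enum_rank x].
apply/forallP=> x; apply/forallP=> y; apply/implyP=> xy.
rewrite !ffunE (inj_eq enum_rank_inj).
by apply: contraTneq xy => ->; rewrite adj_irrefl.
Qed.

Definition chi : nat := ex_minn (ex_intro colorable #|G| colorable_card).

Definition deg (x : G) : nat := #|[set y | adj x y]|.

Definition edges : {set {set G}} :=
  [set e | [exists x, exists y, adj x y && (e == [set x; y])]].

Local Open Scope ring_scope.

(* An edge e is a two-element set {i, j}, so the product and the sum over its
   elements are d_i d_j and d_i + d_j. *)
Definition GA (R : rcfType) : R :=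
  \sum_(e in edges)
    2 * Num.sqrt (\prod_(x in e) (deg x)%:R) / (\sum_(x in e) (deg x)%:R).

Definition avg_deg (R : rcfType) : R := 2 * #|edges|%:R / #|G|%:R.

End Invariants.

(* Main.v *)
(* Every edge of [L n k] has an end in the clique, of degree n - 1, and its other
   end has degree at least k; since degrees are at most n, its GA weight is at
   least sqrt (k (n - 1)) / n, which is at least (k + 1) / n once n > (k + 1)^2.
   Summing over the m edges gives GA >= m (k + 1) / n = (k + 1) avg_deg / 2, and
   k + 1 colours suffice. *)
Require Import Defs.
From HB Require Import structures.
From mathcomp Require Import all_boot all_order all_algebra.

Set Implicit Arguments.
Unset Strict Implicit.
Unset Printing Implicit Defensive.

Import Order.TTheory GRing.Theory Num.Theory.
Local Open Scope ring_scope.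

Lemma chi_le (G : sgraph) (c : nat) : colorable G c -> (chi G <= c)%N.
Proof. by rewrite /chi; case: ex_minnP => m _ min_m /min_m. Qed.

Lemma edgesP (G : sgraph) (e : {set G}) :
  reflect (exists x y, adj x y /\ e = [set x; y]) (e \in edges G).
Proof.
rewrite inE; apply: (iffP existsP) => [[x /existsP[y /andP[xy /eqP ->]]]|].
  by exists x, y.
by case=> x [y [xy ->]]; exists x; apply/existsP; exists y; rewrite xy eqxx.
Qed.

(** The square root is at least [c] by hypothesis, and the degree sum is at most [2 * #|G|]. *)
Lemma GA_weight_ge (R : rcfType) (G : sgraph) (c : nat) (x y : G) :
  adj x y -> (c ^ 2 <= deg x * deg y)%N ->
  c%:R / #|G|%:R <= 2 * Num.sqrt (\prod_(z in [set x; y]) (deg z)%:R)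
                      / (\sum_(z in [set x; y]) (deg z)%:R) :> R.
Proof.
move=> xy le_c.
have neq_xy : x != y by apply: contraTneq xy => ->; rewrite adj_irrefl.
have dx_gt0 : (0 < deg x)%N by apply/card_gt0P; exists y; rewrite inE.
have cardG_gt0 : (0 < #|G|)%N by apply/card_gt0P; exists x.
rewrite !big_setU1 ?inE //= !big_set1 -natrM -natrD.
have le_sum : (deg x + deg y <= 2 * #|G|)%N.
  by rewrite mul2n -addnn leq_add ?max_card.
rewrite ler_pdivlMr ?ltr0n ?addn_gt0 ?dx_gt0 // mulrAC ler_pdivrMr ?ltr0n //.
have le_sqrt : c%:R <= Num.sqrt (deg x * deg y)%:R :> R.
  by rewrite -[c%:R]ger0_norm ?ler0n // -sqrtr_sqr ler_sqrt ?ler0n // -natrX ler_nat.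
rewrite [2 * _]mulrC -mulrA; apply: ler_pM => //.
by rewrite -natrM ler_nat.
Qed.

(** One edge must exist: otherwise [avg_deg] is 0 and the quotient takes the default value 0. *)
Lemma le_GA_div_avg_deg (R : rcfType) (G : sgraph) (c : nat) :
  (exists x y : G, adj x y) ->
  (forall x y : G, adj x y -> (c ^ 2 <= deg x * deg y)%N) ->
  c%:R <= 2 * GA G R / avg_deg G R.
Proof.
move=> [x0 [y0 xy0]] le_c.
have cardG_gt0 : (0 < #|G|)%N by apply/card_gt0P; exists x0.
have edges_gt0 : (0 < #|edges G|)%N.
  by apply/card_gt0P; exists [set x0; y0]; apply/edgesP; exists x0, y0.
rewrite /avg_deg ler_pdivlMr ?divr_gt0 ?mulr_gt0 ?ltr0n //.
rewrite -mulrA mulrCA ler_pM2l ?ltr0n // mulrCA mulr_natl.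
(* The left side, a multiple of [c / #|G|], becomes a constant sum over the edges, so the bound is
   termwise. *)
rewrite -sumr_const; apply: ler_sum => e /edgesP[x [y [xy ->]]].
exact: GA_weight_ge xy (le_c _ _ xy).
Qed.

(** Clique vertices keep their own indices as colours; all others share the last colour. *)
Lemma colorable_L (n k : nat) : colorable (L n k) k.+1.
Proof.
apply/existsP; exists [ffun u : L n k =>
  match u with inl i => widen_ord (leqnSn k) i | inr _ => ord_max end].
apply/forallP=> x; apply/forallP=> y; apply/implyP.
rewrite !ffunE; case: x y => [i|i] [j|j] //= _; rewrite -val_eqE /=.
  by rewrite neq_ltn ltn_ord.
by rewrite neq_ltn ltn_ord orbT.
Qed.

(** The neighbourhood is the complement of the vertex itself. For [k > n] the truncated [L n k] has
    [k] vertices instead of [n]. *)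
Lemma deg_L_clique (n k : nat) (i : 'I_k) :
  (k <= n)%N -> deg (inl i : L n k) = n.-1.
Proof.
move=> le_kn; rewrite /deg -[in RHS](card_L le_kn) -(cardsC1 (inl i : L n k)).
by apply: eq_card => -[j|j]; rewrite !inE //= eq_sym.
Qed.

Lemma deg_L_indep (n k : nat) (j : 'I_(n - k)) : deg (inr j : L n k) = k.
Proof.
rewrite /deg -[RHS]card_ord -[RHS](card_imset _ (@inl_inj _ 'I_(n - k))).
apply: eq_card => -[i|i]; rewrite !inE /=.
  by rewrite mem_imset //; apply: inl_inj.
by apply/esym/imsetP; case.
Qed.

Theorem theorem8 (R : rcfType) (k : nat) (hk : (2 <= k)%N) :
  exists N : nat, forall n : nat, (N <= n)%N ->
    (chi (L n k))%:R <= 2 * GA (L n k) R / avg_deg (L n k) R.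
Proof.
(* The extra 1 pays for the clique degree being [n.-1]. *)
exists (k.+1 ^ 2).+1 => n le_Nn.
have le_n1 : (k.+1 ^ 2 <= n.-1)%N by case: n le_Nn.
have le_kn1 : (k <= n.-1)%N.
  by apply: leq_trans le_n1; rewrite ltnW // leq_pmulr.
have le_kn : (k <= n)%N := leq_trans le_kn1 (leq_pred n).
have k_gt0 : (0 < k)%N := ltnW hk.
have le_prod : (k.+1 ^ 2 <= n.-1 * k)%N := leq_trans le_n1 (leq_pmulr _ k_gt0).
apply: (@le_trans _ _ k.+1%:R); first by rewrite ler_nat chi_le ?colorable_L.
apply: le_GA_div_avg_deg => [|[i|i] [j|j] //= _].
- by exists (inl (Ordinal k_gt0)), (inl (Ordinal hk)).
(* Inside the clique both degrees are [n.-1], and [k <= n.-1] reduces this to the mixed case. *)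
- by rewrite !deg_L_clique // (leq_trans le_prod) ?leq_mul2l ?le_kn1 ?orbT.
- by rewrite deg_L_clique // deg_L_indep.
- by rewrite deg_L_clique // deg_L_indep mulnC.
Qed.
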